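(* Let $G$ be a triangle-free simple graph on $n$ vertices, and let $\mu_1(G)\geq \mu_2(G)\geq \dots \geq \mu_n(G)$ be the eigenvalues of its adjacency matrix. Then $$\mu_1(G)+\mu_n(G)\leq (3-2\sqrt{2})n.$$
   Context: All graphs are simple (no loops or multiple edges). A graph is triangle-free if it contains no three mutually adjacent vertices. *)

(* Defs.v *)
From HB Require Import structures.
From mathcomp Require Import all_boot all_order all_algebra.
From mathcomp Require Import reals.
From mathcomp Require Import complex.

Set Implicit Arguments.
Unset Strict Implicit.
Unset Printing Implicit Defensive.

Import Order.TTheory GRing.Theory Num.Theory.
Local Open Scope ring_scope.

Definition simple_graph (T : finType) (e : rel T) : Prop :=
  symmetric e /\ irreflexive e.

Definition triangle_free (T : finType) (e : rel T) : Prop :=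
  forall x y z : T, ~ [/\ e x y, e y z & e x z].

Definition adjmx (R : pzRingType) (T : finType) (e : rel T) : 'M[R]_#|T| :=
  \matrix_(i, j) (e (enum_val i) (enum_val j))%:R.

(* [mu] lists the eigenvalues of [A] with algebraic multiplicity, in
   non-increasing order; it is unique, and exists for symmetric [A] (below). *)
Definition eigenvalue_seq (R : realFieldType) (n : nat) (A : 'M[R]_n)
    (mu : n.-tuple R) : Prop :=
  sorted >=%R mu /\ char_poly A = \prod_(x <- mu) ('X - x%:P).

Lemma eigenvalue_seq_uniq (R : realFieldType) (n : nat) (A : 'M[R]_n)
    (mu nu : n.-tuple R) :
  eigenvalue_seq A mu -> eigenvalue_seq A nu -> mu = nu.
Proof.
move=> [smu Emu] [snu Enu]; apply/val_inj/(sorted_eq (leT := >=%R)) => //.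
- exact: ge_trans.
- by move=> x y; rewrite andbC => /le_anti.
- by apply: prod_XsubC_eq; rewrite -Emu Enu.
Qed.

Lemma eigenvalue_seq_exists (R : rcfType) (n : nat) (A : 'M[R]_n) :
  A^T = A -> exists mu : n.-tuple R, eigenvalue_seq A mu.
Proof.
move=> Asym; pose f := real_complex R.
pose B := map_mx f A.
have Bherm : B \is hermsymmx.
  apply: realsym_hermsym.
    apply/is_hermitianmxP; rewrite expr0 scale1r.
    by rewrite map_mx_id // /B map_trmx Asym.
  apply/mxOverP => i j; rewrite mxE.
  by apply/complex_realP; exists (A i j).
have /orthomx_spectralP EB := hermitian_normalmx Bherm.
have /mxOverP Dreal := hermitian_spectral_diag_real Bherm.
set P := spectralmx B in EB; set D := spectral_diag B in EB Dreal.
have cB : char_poly B = \prod_(i < n) ('X - (D 0 i)%:P).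
  have PU : map_mx polyC P \in unitmx by rewrite map_unitmx spectral_unit.
  have -> : char_poly B = char_poly (diag_mx D).
    rewrite /char_poly /char_poly_mx EB !map_mxM /= map_invmx.
    set Q := map_mx polyC P in PU *.
    have XE : 'X%:M = invmx Q *m 'X%:M *m Q.
      by rewrite -mulmxA -scalar_mxC mulmxA mulVmx // mul1mx.
    by rewrite {1}XE -mulmxBl -mulmxBr !det_mulmx det_inv mulrAC mulVr ?mul1r.
  rewrite char_poly_trig ?diag_mx_is_trig //.
  by apply: eq_bigr => i _; rewrite !mxE eqxx.
pose s := sort >=%R [seq complex.Re (D 0 i) | i <- enum 'I_n].
have ss : size s == n by rewrite size_sort size_map size_enum_ord.
exists (Tuple ss); split; first by apply: sort_sorted => x y; apply: le_total.
apply: (@map_poly_inj _ _ f); rewrite map_char_poly -/B cB rmorph_prod /=.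
rewrite [RHS](perm_big [seq complex.Re (D 0 i) | i <- enum 'I_n]);
  last by rewrite perm_sort.
rewrite big_map big_enum; apply: eq_bigr => i _ /=.
rewrite rmorphB /= map_polyX map_polyC /=.
by have /complex_realP[x ->] := Dreal 0 i.
Qed.

(* Main.v *)
Require Import Defs.
From mathcomp Require Import all_boot all_order all_algebra.
From mathcomp Require Import reals.
From mathcomp Require Import complex ring lra.
Import Order.TTheory GRing.Theory Num.Theory.
Local Open Scope ring_scope.

Set Implicit Arguments.
Unset Strict Implicit.
Unset Printing Implicit Defensive.

(** Let [q] and [-s] be the extreme eigenvalues of the adjacency matrix [A], and
    let [x >= 0] be an eigenvector for [q].  As [A + s I] is positive
    semidefinite, Cauchy-Schwarz applied to [x] and its restriction to the
    (independent) neighbourhood of [u] gives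
    [(q + s) \sum_(v ~ u) x_v ^ 2 <= s \sum_v x_v ^ 2].  Summing over [u] with
    weights [x_u] and using Chebyshev's sum inequality for [x_v] and [x_v ^ 2]
    yields [q (q + s) <= n s], i.e. what Hoffman's bound gives for regular
    graphs.  Maximising [q - s] under this constraint is elementary. *)

(** * Quadratic forms of real symmetric matrices *)

Section QuadraticForms.
Context {R : rcfType} {n : nat}.
Implicit Types (A M : 'M[R]_n) (u v : 'rV[R]_n).

Definition mxform M u v : R := (u *m M *m v^T) 0 0.

Lemma mxformDl M u1 u2 v : mxform M (u1 + u2) v = mxform M u1 v + mxform M u2 v.
Proof. by rewrite /mxform !mulmxDl mxE. Qed.

Lemma mxformZl M a u v : mxform M (a *: u) v = a * mxform M u v.
Proof. by rewrite /mxform -!scalemxAl mxE. Qed.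

Lemma mxformDr M u v1 v2 : mxform M u (v1 + v2) = mxform M u v1 + mxform M u v2.
Proof. by rewrite /mxform linearD mulmxDr mxE. Qed.

Lemma mxformZr M a u v : mxform M u (a *: v) = a * mxform M u v.
Proof. by rewrite /mxform linearZ -scalemxAr mxE. Qed.

Lemma mxformDm M1 M2 u v : mxform (M1 + M2) u v = mxform M1 u v + mxform M2 u v.
Proof. by rewrite /mxform mulmxDr mulmxDl mxE. Qed.

Lemma mxformNm M u v : mxform (- M) u v = - mxform M u v.
Proof. by rewrite /mxform mulmxN mulNmx mxE. Qed.

Lemma mxform_scalar a u v : mxform a%:M u v = a * \sum_i u 0 i * v 0 i.
Proof.
rewrite /mxform mul_mx_scalar -scalemxAl mxE mxE; congr (_ * _).
by apply: eq_bigr => i _; rewrite mxE.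
Qed.

Lemma mxformE M u v : mxform M u v = \sum_i \sum_j u 0 i * M i j * v 0 j.
Proof.
rewrite /mxform mxE exchange_big /=; apply: eq_bigr => j _.
by rewrite !mxE mulr_suml.
Qed.

Lemma mxform_eigen M q u v :
  u *m M = q *: u -> mxform M u v = q * \sum_i u 0 i * v 0 i.
Proof. by rewrite -mxform_scalar /mxform mul_mx_scalar => ->. Qed.

Lemma mxform_sym M u v : M^T = M -> mxform M u v = mxform M v u.
Proof.
move=> Ms; rewrite /mxform -[in LHS]Ms -[LHS](mxE trmx_key (fun i j => _ j i)).
by rewrite -/(trmx _) !trmx_mul !trmxK mulmxA.
Qed.

Lemma sum_sqr_eq0 v : \sum_i v 0 i * v 0 i = 0 -> v = 0.
Proof.
move=> v0; apply/rowP => i; rewrite mxE; apply/eqP; rewrite -[_ == _]orbb -mulf_eq0.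
by apply/eqP; apply: (psumr_eq0P _ v0) => // j _; rewrite -expr2 sqr_ge0.
Qed.

(** The form is nonnegative at every [a *: u + b *: v]; suitable [a] and [b] give the inequality,
    also when [M] is degenerate. *)
Lemma psd_CauchySchwarz M u v :
    M^T = M -> (forall w, 0 <= mxform M w w) ->
  mxform M u v ^+ 2 <= mxform M u u * mxform M v v.
Proof.
move=> Ms Mp.
have quad a b : 0 <= a ^+ 2 * mxform M u u + 2 * a * b * mxform M u v
                     + b ^+ 2 * mxform M v v.
  have := Mp (a *: u + b *: v).
  rewrite !(mxformDl, mxformDr, mxformZl, mxformZr) (mxform_sym v u Ms).
  by congr (0 <= _); ring.
have := Mp v; rewrite le_eqVlt => /predU1P[c0|c_gt0]; last first.
  have := quad (mxform M v v) (- mxform M u v).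
  move=> h; rewrite -subr_ge0 -(pmulr_rge0 _ c_gt0); move: h.
  by congr (0 <= _); ring.
(* Here [v] is isotropic. With [U = mxform M u u] and [m = mxform M u v], this choice gives
   [0 <= - m ^+ 2 * (U + 2)], which forces [m = 0]. *)
rewrite -c0 mulr0; have := quad (mxform M u v) (- (mxform M u u + 1)).
rewrite -c0 mulr0 addr0 => h.
have := Mp u; have := sqr_ge0 (mxform M u v); nra.
Qed.

(** Cauchy-Schwarz for [v] and [v *m M] shows that the squared norm of [v *m M] vanishes. *)
Lemma psd_isotropic_ker M v :
    M^T = M -> (forall w, 0 <= mxform M w w) -> mxform M v v = 0 ->
  v *m M = 0.
Proof.
move=> Ms Mp v0; apply: sum_sqr_eq0.
have := @psd_CauchySchwarz M v (v *m M) Ms Mp; rewrite v0 mul0r => h.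
have vM0 : mxform M v (v *m M) = 0.
  by apply/eqP; rewrite -sqrf_eq0 eq_le h sqr_ge0.
rewrite -[RHS]vM0 /mxform [RHS]mxE.
by apply: eq_bigr => i _; rewrite [(_ ^T) _ _]mxE.
Qed.

(** Over the complex numbers [A] is unitarily diagonalisable; in the coordinates [z] of [v] both
    sides become weighted sums of the [|z_i| ^ 2]. *)
Lemma symmx_form_ge A (c : R) v :
    A^T = A -> (forall a, eigenvalue A a -> c <= a) ->
  c * \sum_i v 0 i * v 0 i <= mxform A v v.
Proof.
move=> Asym Ac; pose f := real_complex R; pose B := map_mx f A.
have Bherm : B \is hermsymmx.
  apply: realsym_hermsym.
    apply/is_hermitianmxP; rewrite expr0 scale1r.
    by rewrite map_mx_id // /B map_trmx Asym.
  apply/mxOverP => i j; rewrite mxE.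
  by apply/complex_realP; exists (A i j).
have /orthomx_spectralP EB := hermitian_normalmx Bherm.
have /mxOverP Dreal := hermitian_spectral_diag_real Bherm.
have Punit := spectral_unit B.
have Pun := spectral_unitarymx B.
set P := spectralmx B in EB Punit Pun; set D := spectral_diag B in EB Dreal.
(* Row [i] of [P] is an eigenvector of [B] for the real number [D 0 i], which is then a root of the
   characteristic polynomial of [A] itself. *)
have Dc i : f c <= D 0 i.
  have /complex_realP[d Dd] := Dreal 0 i.
  rewrite Dd lecR; apply: Ac; rewrite eigenvalue_root_char.
  rewrite -(fmorph_root f) /= map_char_poly -/B -eigenvalue_root_char.
  apply/eigenvalueP; exists (row i P).
    rewrite -row_mul EB !mulmxA mulmxV // mul1mx.
    by rewrite -[real_complex_def _ _]Dd row_mul row_diag_mx -scalemxAl -rowE.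
  apply/negP => /eqP Pi0.
  have : row i P *m invmx P = 0 by rewrite Pi0 mul0mx.
  rewrite -row_mul mulmxV // => /rowP/(_ i) /eqP.
  by rewrite !mxE eqxx oner_eq0.
pose w := map_mx f v.
have wreal : (w ^t*)%sesqui = w^T.
  apply/matrixP => i j; rewrite !mxE conj_Creal //.
  by apply/complex_realP; eexists.
have [z zE] : exists z, z = w *m invmx P by eexists.
have zstar : P *m w^T = (z ^t*)%sesqui.
  by rewrite zE invmx_unitary // trmx_mul map_mxM wreal trmxCK.
have key1 : f (mxform A v v) = \sum_i D 0 i * `|z 0 i| ^+ 2.
  have -> : f (mxform A v v) = (w *m B *m w^T) 0 0.
    by rewrite /w /B map_trmx -!map_mxM [RHS]mxE.
  rewrite EB !mulmxA -zE -!mulmxA zstar mxE; apply: eq_bigr => i _.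
  by rewrite mul_diag_mx !mxE normCK; ring.
have key2 : f (\sum_i v 0 i * v 0 i) = \sum_i `|z 0 i| ^+ 2.
  have -> : f (\sum_i v 0 i * v 0 i) = (w *m invmx P *m (P *m w^T)) 0 0.
    rewrite mulmxA mulmxKV // [RHS]mxE /f rmorph_sum; apply: eq_bigr => i _.
    by rewrite !mxE rmorphM.
  rewrite zstar -zE mxE; apply: eq_bigr => i _.
  by rewrite !mxE normCK.
rewrite /f in key1 key2 Dc.
rewrite -lecR rmorphM /= key2 key1 mulr_sumr.
by apply: ler_sum => i _; apply: ler_wpM2r => //; rewrite exprn_ge0.
Qed.

Lemma symmx_form_le A (c : R) v :
    A^T = A -> (forall a, eigenvalue A a -> a <= c) ->
  mxform A v v <= c * \sum_i v 0 i * v 0 i.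
Proof.
move=> Asym Ac; rewrite -lerN2 -mxformNm -mulNr; apply: symmx_form_ge.
  by rewrite linearN /= Asym.
move=> a /eigenvalueP[w wA w0]; rewrite lerNl; apply: Ac.
by apply/eigenvalueP; exists w => //; rewrite -[A]opprK mulmxN wA scaleNr.
Qed.

(* [|x|] also maximises the Rayleigh quotient of a nonnegative matrix. *)
Lemma symmx_nneg_eigenvector A q :
    A^T = A -> (forall i j, 0 <= A i j) ->
    (forall a, eigenvalue A a -> a <= q) -> eigenvalue A q ->
  exists x : 'rV[R]_n, [/\ x *m A = q *: x, x != 0 & forall i, 0 <= x 0 i].
Proof.
move=> Asym A0 Aq /eigenvalueP[x xA x0].
pose y : 'rV[R]_n := \row_i `|x 0 i|.
have yy : \sum_i y 0 i * y 0 i = \sum_i x 0 i * x 0 i.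
  by apply: eq_bigr => i _; rewrite !mxE -!expr2 real_normK ?num_real.
have Mform w : mxform (q%:M - A) w w = q * \sum_i w 0 i * w 0 i - mxform A w w.
  by rewrite mxformDm mxformNm mxform_scalar.
exists y; split; last by move=> i; rewrite mxE.
(* [y] is isotropic for the positive semidefinite [q%:M - A], so it lies in the kernel. *)
- have /eqP : y *m (q%:M - A) = 0.
    apply: psd_isotropic_ker.
    + by rewrite linearB /= tr_scalar_mx Asym.
    + by move=> w; rewrite Mform subr_ge0 symmx_form_le.
    apply/eqP; rewrite eq_le Mform subr_ge0 subr_le0 symmx_form_le // andbT.
    rewrite yy -(mxform_eigen _ xA) !mxformE; apply: ler_sum => i _.
    apply: ler_sum => j _; rewrite !mxE; apply: le_trans (ler_norm _) _.
    by rewrite !normrM (ger0_norm (A0 i j)).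
  by rewrite mulmxBr mul_mx_scalar subr_eq0 => /eqP.
- apply: contra_neq x0 => y0; apply: sum_sqr_eq0; rewrite -yy y0.
  by rewrite big1 // => i _; rewrite mxE mul0r.
Qed.

End QuadraticForms.

(** * Chebyshev's sum inequality *)

Lemma Chebyshev_sum_sqr (R : realDomainType) (I : finType) (x : I -> R) :
    (forall i, 0 <= x i) ->
  (\sum_i x i) * (\sum_i x i ^+ 2) <= #|I|%:R * \sum_i x i ^+ 3.
Proof.
move=> x0.
(* Both factors have the same sign; the expanded double sum is twice the difference of the two
   sides. *)
have h : 0 <= \sum_i \sum_j (x i - x j) * (x i ^+ 2 - x j ^+ 2).
  apply: sumr_ge0 => i _; apply: sumr_ge0 => j _.
  have -> : (x i - x j) * (x i ^+ 2 - x j ^+ 2)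
            = (x i - x j) ^+ 2 * (x i + x j) by ring.
  by rewrite mulr_ge0 ?sqr_ge0 ?addr_ge0.
have sum_cst (c : R) : \sum_(i : I) c = #|I|%:R * c.
  by rewrite sumr_const mulr_natl.
have E i : \sum_j (x i - x j) * (x i ^+ 2 - x j ^+ 2)
   = #|I|%:R * x i ^+ 3 - x i * (\sum_j x j ^+ 2)
     - x i ^+ 2 * (\sum_j x j) + \sum_j x j ^+ 3.
  rewrite -sum_cst !mulr_sumr -!sumrB -big_split /=.
  by apply: eq_bigr => j _; ring.
move: h; under eq_bigr do rewrite E.
rewrite big_split !sumrB /= -!mulr_suml -mulr_sumr sum_cst; lra.
Qed.

(** * The Hoffman-type inequality for triangle-free graphs *)

Section TriangleFree.
Context {R : rcfType} {n : nat} (A : 'M[R]_n) (r : rel 'I_n).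
Context (AE : forall i j, A i j = (r i j)%:R) (r_sym : symmetric r).
Context (r_tf : forall i j k, ~ [/\ r i j, r j k & r i k]).

Let Asym : A^T = A.
Proof. by apply/matrixP => i j; rewrite mxE !AE r_sym. Qed.

Lemma nbhd_eigenvector_mass (q s : R) (x : 'rV[R]_n) u :
    x *m A = q *: x -> (forall v, 0 <= mxform (A + s%:M) v v) ->
    0 <= s -> 0 < q + s ->
  (q + s) * (\sum_(j | r u j) x 0 j ^+ 2) <= s * \sum_j x 0 j ^+ 2.
Proof.
move=> xA Mp s0 qs.
pose y : 'rV[R]_n := \row_j (if r u j then x 0 j else 0).
have yE j : y 0 j = if r u j then x 0 j else 0 by rewrite mxE.
(* Two adjacent neighbours of [u] would form a triangle with it. *)
have yAy : mxform A y y = 0.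
  rewrite mxformE big1 // => i _; rewrite big1 // => j _; rewrite !yE AE.
  case: ifP => ui; case: ifP => uj; rewrite ?mul0r ?mulr0 //.
  case rij: (r i j); last by rewrite mulr0 mul0r.
  by case: (@r_tf u i j).
have sumF (z : 'rV[R]_n) : (forall j, z 0 j * y 0 j = y 0 j ^+ 2) ->
    \sum_j z 0 j * y 0 j = \sum_(j | r u j) x 0 j ^+ 2.
  move=> zy; rewrite [RHS]big_mkcond; apply: eq_bigr => j _.
  by rewrite zy yE; case: ifP; rewrite ?expr0n.
have sumX : \sum_j x 0 j * x 0 j = \sum_j x 0 j ^+ 2 by apply: eq_bigr.
have Msym : (A + s%:M)^T = A + s%:M by rewrite linearD /= tr_scalar_mx Asym.
have := psd_CauchySchwarz x y Msym Mp.
rewrite !mxformDm !(mxform_eigen _ xA) yAy !mxform_scalar add0r sumX.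
rewrite (sumF x) ?(sumF y) //; last first.
  by move=> j; rewrite yE; case: ifP; rewrite ?mulr0 ?expr0n.
set F := \sum_(j | _) _; set X := \sum_j _.
have X0 : 0 <= X by apply: sumr_ge0 => j _; rewrite sqr_ge0.
have : 0 <= F by apply: sumr_ge0 => j _; rewrite sqr_ge0.
(* Cauchy-Schwarz reads [((q + s) F) ^ 2 <= (q + s) X * (s F)]; it is divided by [(q + s) F], so
   [F = 0] is treated apart. *)
rewrite le_eqVlt => /predU1P[<- _|F0]; first by rewrite mulr0 mulr_ge0.
rewrite -!mulrDl => h; rewrite -(ler_pM2l (mulr_gt0 qs F0)).
by move: h; congr (_ <= _); ring.
Qed.

Lemma triangle_free_eigenvalue_bound (q s : R) :
    (forall a, eigenvalue A a -> - s <= a <= q) -> eigenvalue A q ->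
    0 < q -> 0 <= s ->
  q * (q + s) <= n%:R * s.
Proof.
move=> Aqs Aq q0 s0; have qs : 0 < q + s by rewrite ltr_pwDl.
have [x [xA x0 xge0]] : exists x : 'rV[R]_n,
    [/\ x *m A = q *: x, x != 0 & forall i, 0 <= x 0 i].
  apply: symmx_nneg_eigenvector => //; first by move=> i j; rewrite AE.
  by move=> a /Aqs/andP[].
have Mp v : 0 <= mxform (A + s%:M) v v.
  rewrite mxformDm mxform_scalar -lerBlDr sub0r -mulNr.
  by apply: symmx_form_ge => // a /Aqs/andP[].
have nbhd u := nbhd_eigenvector_mass u xA Mp s0 qs.
have [i0 xi0] : exists i, 0 < x 0 i.
  have /rV0Pn[i xi] := x0; exists i; by rewrite lt0r xi xge0.
have S1 : 0 < \sum_i x 0 i.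
  by rewrite (bigD1 i0) //= ltr_pwDl // sumr_ge0.
have X0 : 0 < \sum_i x 0 i ^+ 2.
  rewrite (bigD1 i0) //= ltr_pwDl ?exprn_gt0 //.
  by rewrite sumr_ge0 // => i _; rewrite sqr_ge0.
(* After exchanging the sums, the weights [x_u] over the neighbours [u] of [j] add up to [q x_j]. *)
have S3E : \sum_u x 0 u * (\sum_(j | r u j) x 0 j ^+ 2)
           = q * \sum_j x 0 j ^+ 3.
  under eq_bigr => u _ do rewrite big_mkcond mulr_sumr.
  rewrite exchange_big mulr_sumr; apply: eq_bigr => j _ /=.
  have /rowP/(_ j) := xA; rewrite !mxE => h.
  rewrite exprS mulrA -h mulr_suml; apply: eq_bigr => u _.
  by rewrite AE; case: (r u j); rewrite ?mulr1 ?mulr0 ?mul0r.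
have sum_nbhd : (q + s) * (q * \sum_j x 0 j ^+ 3)
                <= s * (\sum_j x 0 j ^+ 2) * \sum_u x 0 u.
  rewrite -S3E [leLHS]mulr_sumr [leRHS]mulr_sumr; apply: ler_sum => u _.
  by rewrite mulrCA [leRHS]mulrC; apply: ler_wpM2l.
have := Chebyshev_sum_sqr xge0; rewrite card_ord => cheb.
rewrite -(ler_pM2r (mulr_gt0 S1 X0)).
apply: (@le_trans _ _ (q * (q + s) * (n%:R * \sum_i x 0 i ^+ 3))).
  by rewrite ler_pM2l // mulr_gt0.
have := ler_wpM2l (ler0n R n) sum_nbhd.
by congr (_ <= _); ring.
Qed.

End TriangleFree.

(** * Optimisation under the constraint, and the theorem *)

Lemma hoffman_constraint_max (R : rcfType) (q s m : R) :
    0 < q -> 0 <= s -> 0 <= m -> q * (q + s) <= m * s ->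
  q - s <= (3 - 2 * Num.sqrt 2) * m.
Proof.
move=> q0 s0 m0 qsm; set k := Num.sqrt 2.
have k2 : k ^+ 2 = 2 by rewrite sqr_sqrtr.
(* Hence [s >= q ^ 2 / (m - q)], and [q - q ^ 2 / (m - q)] is largest at [q = (1 - k / 2) m], with
   value [(3 - 2 k) m]. *)
have qm : q < m by nra.
rewrite leNgt; apply/negP => lt_qs.
have h : 0 < (m - q) * (q - (3 - 2 * k) * m - s).
  by apply: mulr_gt0; lra.
(* The quadratic [2 q^2 - (4 - 2 k) q m + (3 - 2 k) m^2] has zero discriminant. *)
have := sqr_ge0 (2 * q - (2 - k) * m).
have -> : (2 * q - (2 - k) * m) ^+ 2
  = 4 * q ^+ 2 - 4 * (2 - k) * q * m + (4 - 4 * k + k ^+ 2) * m ^+ 2 by ring.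
rewrite k2; nra.
Qed.

Lemma mem_eigenvalue_seq (R : realFieldType) (n : nat) (A : 'M[R]_n)
    (mu : n.-tuple R) a :
  eigenvalue_seq A mu -> eigenvalue A a = (a \in tval mu).
Proof. by case=> _ E; rewrite eigenvalue_root_char E root_prod_XsubC. Qed.

Theorem theorem1 (R : realType) (T : finType) (e : rel T)
    (mu : #|T|.-tuple R) :
  simple_graph e -> triangle_free e ->
  (0 < #|T|)%N -> eigenvalue_seq (adjmx R e) mu ->
  mu`_0 + mu`_(#|T|.-1) <= (3 - 2 * Num.sqrt 2) * #|T|%:R.
Proof.
move=> [e_sym e_irr] e_tf T0 Amu; set A := adjmx R e in Amu *.
pose r : rel 'I_#|T| := fun i j => e (enum_val i) (enum_val j).
have AE i j : A i j = (r i j)%:R by rewrite mxE.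
have r_sym : symmetric r by move=> i j; apply: e_sym.
have Asym : A^T = A by apply/matrixP => i j; rewrite mxE !AE r_sym.
have mu_sz : size mu = #|T| by rewrite size_tuple.
have mu_le i j : (i <= j < #|T|)%N -> mu`_j <= mu`_i.
  case/andP => ij jT; have [smu _] := Amu.
  apply: (sorted_leq_nth ge_trans ge_refl 0 smu) => //; rewrite inE mu_sz //.
  exact: leq_ltn_trans jT.
have Abd a : eigenvalue A a -> - - mu`_(#|T|.-1) <= a <= mu`_0.
  rewrite (mem_eigenvalue_seq _ Amu) opprK => a_mu.
  have := a_mu; rewrite -index_mem mu_sz => iT; rewrite -(nth_index 0 a_mu).
  by rewrite !mu_le ?iT // -ltnS prednK // iT leqnn.
have Aq : eigenvalue A mu`_0 by rewrite (mem_eigenvalue_seq _ Amu) mem_nth ?mu_sz.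
(* The form of [A] at a basis vector is a diagonal entry, zero as there are no loops, so the least
   eigenvalue is at most 0. *)
have s0 : 0 <= - mu`_(#|T|.-1).
  pose i0 := Ordinal T0.
  have := @symmx_form_ge R _ A (mu`_(#|T|.-1)) (delta_mx 0 i0) Asym.
  rewrite /mxform -rowE trmx_delta -colE !mxE e_irr.
  rewrite (bigD1 i0) //= big1 => [|i ii0]; last first.
    by rewrite !mxE (negPf ii0) andbF mulr0.
  rewrite !mxE !eqxx addr0 !mulr1 oppr_ge0; apply=> a /Abd.
  by rewrite opprK => /andP[].
have [q0|q0] := ltP 0 mu`_0.
  rewrite -[X in _ + X]opprK; apply: hoffman_constraint_max => //.
  apply: (triangle_free_eigenvalue_bound AE r_sym) => // i j k.
  exact: e_tf.
(* Now both extreme eigenvalues are nonpositive, and it remains to see that [3 - 2 * Num.sqrt 2] is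
   nonnegative. *)
apply: (@le_trans _ _ 0); first lra.
rewrite mulr_ge0 //; set k := Num.sqrt 2.
have : k ^+ 2 = 2 by rewrite sqr_sqrtr.
by nra.
Qed.
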